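(* Let $G$ and $H$ be undirected simple graphs on $N=\{1,\dots,n\}$ such that $E_G\cap E_H=\{ij\}$ consists of a single edge. Then $\mathcal M(G,H)=\mathrm{PD}_{ij}\oplus\bigoplus_{k\in N\setminus\{i,j\}}\mathrm{PD}_{\{k\}}$, that is, $\mathcal M(G,H)$ is the set of all $\Sigma\in\mathrm{PD}_n$ whose only possibly non-zero off-diagonal entries are those at positions $(i,j)$ and $(j,i)$. In particular, $\mathcal M_1(G,H)$ is connected and smooth of the maximal dimension $|E_G\cap E_H|=1$.
   Context: $E_G$ denotes the edge set of $G$. $\mathrm{PD}_n$ is the set of real symmetric positive definite $n\times n$ matrices, and for $N'\subseteq N$, $\mathrm{PD}_{N'}$ is the set of positive definite matrices with rows and columns indexed by $N'$; $\mathrm{PD}_{ij}=\mathrm{PD}_{\{i,j\}}$. Direct sums denote sets of block-diagonal matrices with blocks indexed by the given disjoint index sets. $$\mathcal M(G,H)=\{\Sigma\in\mathrm{PD}_n : (\Sigma^{-1})_{kl}=0 \text{ for all } k\ne l,\ kl\notin E_G;\ \Sigma_{kl}=0\text{ for all } k\neq l,\ kl\notin E_H\},$$ and $\mathcal M_1(G,H)$ is the subset of matrices in $\mathcal M(G,H)$ with all diagonal entries $1$. Connectedness is in the Euclidean topology. For a semi-algebraic set $\Theta\subseteq\mathbb R^m$, $\overline\Theta$ is its real Zariski closure and $\dim\Theta$ is the Krull dimension of $\mathbb R[x_1,\dots,x_m]/\mathcal I(\Theta)$, with $\mathcal I(\Theta)$ the vanishing ideal; $\Theta$ is smooth if every $p\in\Theta$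 lies in a unique irreducible component $Z$ of $\overline\Theta$ and the kernel of the Jacobian matrix at $p$ of generators of $\mathcal I(Z)$ has dimension $\dim Z$. *)

(* Defs.v *)
From HB Require Import structures.
From mathcomp Require Import all_boot all_order all_algebra ring_quotient.
From mathcomp Require Import all_classical all_reals all_analysis.
(* The notations of [mpoly] clash with those of the analysis library. *)
From mathcomp Require Import -(notations) mpoly.

Set Implicit Arguments.
Unset Strict Implicit.
Unset Printing Implicit Defensive.

Import Order.TTheory GRing.Theory Num.Theory.
Import numFieldNormedType.Exports.

Local Open Scope classical_set_scope.
Local Open Scope ring_scope.

(* The edge joining [k] and [l] is the unordered pair [[set k; l]%SET]. *)
Record sgraph (n : nat) := SGraph {
  edges : {set {set 'I_n}};
  edges_card : forall e, e \in edges -> #|e| = 2%N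
}.

Section Matrices.
Variable R : realType.

Definition PD (n : nat) : set 'M[R]_n :=
  [set A | A^T = A /\
           forall x : 'rV[R]_n, x != 0 -> 0 < (x *m A *m x^T) 0 0].

Definition block (n : nat) (B : {set 'I_n}) (A : 'M[R]_n) : 'M[R]_#|B| :=
  mxsub (fun a : 'I_#|B| => enum_val a) (fun a : 'I_#|B| => enum_val a) A.

(* Matrices with rows and columns indexed by [B] are represented in
   ['M[R]_#|B|] through the increasing enumeration of [B]. *)
Definition PD_of (n : nat) (B : {set 'I_n}) : set 'M[R]_#|B| := @PD #|B|.

(* [direct_sum P S] is the direct sum over the blocks [B] in [P] of the sets
   [S B]; it is meant for [P] a partition of [[set: 'I_n]]. *)
Definition direct_sum (n : nat) (P : {set {set 'I_n}})
    (S : forall B : {set 'I_n}, set 'M[R]_#|B|) : set 'M[R]_n :=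
  [set A | (forall B, B \in P -> S B (block B A)) /\
           forall k l, (forall B, B \in P -> ~~ ((k \in B) && (l \in B))) ->
             A k l = 0].

Definition model (n : nat) (G H : sgraph n) : set 'M[R]_n :=
  [set S | [/\ PD S,
     forall k l, k != l -> [set k; l]%SET \notin edges G -> invmx S k l = 0 &
     forall k l, k != l -> [set k; l]%SET \notin edges H -> S k l = 0]].

Definition model1 (n : nat) (G H : sgraph n) : set 'M[R]_n :=
  [set S | model G H S /\ forall k, S k k = 1].

End Matrices.

Arguments PD {R n}.
Arguments PD_of {R n} B.
Arguments model R {n} G H.
Arguments model1 R {n} G H.

(* [P 0 < ... < P d] is a strict chain of prime ideals; the values of [P]
   beyond [d] are irrelevant. *)
Definition prime_chain (A : comNzRingType) (d : nat)
    (P : nat -> prime_idealr A) : Prop :=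
  forall a, (a < d)%N ->
    {subset P a <= P a.+1} /\ ~ {subset P a.+1 <= P a}.

Definition has_krull_dim (A : comNzRingType) (d : nat) : Prop :=
  (exists P : nat -> prime_idealr A, prime_chain d P) /\
  (forall d' (P : nat -> prime_idealr A), prime_chain d' P -> (d' <= d)%N).

Section RealAlgebraicGeometry.
Variables (R : realType) (m : nat).

Definition peval (x : 'rV[R]_m) (p : mpoly m R) : R :=
  meval (fun k => x 0 k) p.

Definition vanishing (T : set 'rV[R]_m) : set (mpoly m R) :=
  [set p | forall x, T x -> peval x p = 0].

Definition zariski_closure (T : set 'rV[R]_m) : set 'rV[R]_m :=
  [set x | forall p, vanishing T p -> peval x p = 0].

Definition zariski_closed (T : set 'rV[R]_m) : Prop := zariski_closure T = T.

(* The Krull dimension of [R[x_1, ..., x_m] / I(T)] is [d].  The library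
   quotient is by proper ideals, so that the empty set has no dimension. *)
Definition has_dim (T : set 'rV[R]_m) (d : nat) : Prop :=
  exists2 I : idealr (mpoly m R),
    (forall p, p \in I <-> vanishing T p) & has_krull_dim {ideal_quot I} d.

Definition zariski_irreducible (Z : set 'rV[R]_m) : Prop :=
  Z !=set0 /\
  forall A B, zariski_closed A -> zariski_closed B ->
    Z `<=` A `|` B -> Z `<=` A \/ Z `<=` B.

Definition irreducible_component (W Z : set 'rV[R]_m) : Prop :=
  [/\ Z `<=` W, zariski_closed Z, zariski_irreducible Z &
      forall Z', Z' `<=` W -> zariski_closed Z' -> zariski_irreducible Z' ->
        Z `<=` Z' -> Z' = Z].

Definition generates (r : nat) (f : 'I_r -> mpoly m R)
    (J : set (mpoly m R)) : Prop :=
  forall p, J p <-> exists c : 'I_r -> mpoly m R, p = \sum_k c k * f k.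

Definition jacobian (r : nat) (f : 'I_r -> mpoly m R) (x : 'rV[R]_m) :
    'M[R]_(r, m) :=
  \matrix_(a, b) peval x (mderiv b (f a)).

(* [kermx] is the row kernel, so the kernel of a matrix [J] acting on column
   vectors is the row space of [kermx J^T]. *)
Definition smooth (T : set 'rV[R]_m) : Prop :=
  forall x, T x -> exists Z,
    [/\ irreducible_component (zariski_closure T) Z, Z x,
        forall Z', irreducible_component (zariski_closure T) Z' -> Z' x ->
          Z' = Z &
        exists (r : nat) (f : 'I_r -> mpoly m R),
          generates f (vanishing Z) /\
          has_dim Z (\rank (kermx (jacobian f x)^T))].

End RealAlgebraicGeometry.

(* A set of [n x n] matrices as a set of points of [R^(n * n)]. *)
Definition mx_points (R : realType) (n : nat) (T : set 'M[R]_n) :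
    set 'rV[R]_(n * n) :=
  [set mxvec A | A in T].

(* Main.v *)
(* Write K for the inverse of Sigma.  For a vertex k outside {i, j}, the only
   nonzero term of (Sigma K)_kk = 1 is Sigma_kk K_kk, because E_G and E_H share
   no edge at k.  For a positive definite matrix Sigma_kk K_kk >= 1, with
   equality only if k is decoupled from all the other vertices; so only the
   entry (i, j) survives off the diagonal.

   Hence the matrices with unit diagonal are the 1 + a (E_ij + E_ji) with
   -1 < a < 1, an infinite subset of an affine line.  Restricting polynomials to
   the line is a surjective ring morphism onto R[t] whose kernel is the vanishing
   ideal.  The Zariski closure is thus the whole line, which is irreducible, the
   Krull dimension is that of R[t], and the vanishing ideal is generated by
   affine forms whose Jacobian has the direction of the line as kernel. *)

Require Import Defs.
From HB Require Import structures.
From mathcomp Require Import all_boot all_order all_algebra ring_quotient.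
From mathcomp Require Import all_classical all_reals all_analysis.
From mathcomp Require Import -(notations) mpoly.
From mathcomp Require Import lra.

Set Implicit Arguments.
Unset Strict Implicit.
Unset Printing Implicit Defensive.

Import Order.TTheory GRing.Theory Num.Theory.
Import numFieldNormedType.Exports.

Local Open Scope classical_set_scope.
Local Open Scope ring_scope.

(** * Krull dimension and its transport along ring morphisms *)

Section KrullDimension.

Definition make_prime (A : comNzRingType) (S : pred A) (S_ideal : idealr_closed S)
    (S_prime : prime_idealr_closed S) : prime_idealr A :=
  HB.pack_for (prime_idealr A) S (isIdealr.Build A S S_ideal)
    (isPrimeIdealrClosed.Build A S S_prime).

Lemma make_primeE (A : comNzRingType) (S : pred A) (S_ideal : idealr_closed S)
    (S_prime : prime_idealr_closed S) x :
  (x \in make_prime S_ideal S_prime) = S x.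
Proof. by []. Qed.

Section Preimage.
Variables (A B : comNzRingType) (f : {rmorphism A -> B}) (P : prime_idealr B).

Let S : pred A := fun x => f x \in P.

Let S_ideal : idealr_closed S.
Proof.
have SE x : (x \in S) = (f x \in P) by [].
split=> [||a u v]; rewrite !SE.
- by rewrite rmorph0 rpred0.
- by rewrite rmorph1 idealr1.
- by move=> Pu Pv; rewrite rmorphD rmorphM rpredD // idealMr.
Qed.

Let S_prime : prime_idealr_closed S.
Proof.
have SE x : (x \in S) = (f x \in P) by [].
by move=> u v; rewrite !SE rmorphM prime_idealrM.
Qed.

Definition preim_prime : prime_idealr A := make_prime S_ideal S_prime.

Lemma mem_preim_prime x : (x \in preim_prime) = (f x \in P).
Proof. by []. Qed.
End Preimage.

(** Surjectivity of [f] keeps the inclusions strict: an element of [P a.+1] outside [P a] lifts to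
    [A]. *)
Lemma prime_chain_preim (A B : comNzRingType) (f : {rmorphism A -> B}) d
    (P : nat -> prime_idealr B) :
  (forall y, exists x, f x = y) -> prime_chain d P ->
  prime_chain d (fun a => preim_prime f (P a)).
Proof.
move=> f_surj Pd a a_d; have [Pa PaS] := Pd a a_d; split=> [x|Pa'].
  by rewrite !mem_preim_prime; apply: Pa.
apply: PaS => y; have [x <-] := f_surj y.
by have := Pa' x; rewrite !mem_preim_prime.
Qed.

Lemma has_krull_dim_iso (A B : comNzRingType) (f : {rmorphism A -> B})
    (g : {rmorphism B -> A}) d :
  cancel f g -> cancel g f -> has_krull_dim B d -> has_krull_dim A d.
Proof.
move=> fK gK [[P Pd] maxd]; split.
  exists (fun a => preim_prime f (P a)); apply: prime_chain_preim => // y.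
  by exists (g y).
move=> d' Q Qd'; apply: (maxd d' (fun a => preim_prime g (Q a))).
by apply: prime_chain_preim => // y; exists (f y).
Qed.

(** * First isomorphism theorem for the quotient by the kernel of [f] *)

Section Quotient.
Variables (A B : comNzRingType) (I : idealr A) (f : {rmorphism A -> B}).
Hypothesis ker_f : forall x, x \in I <-> f x = 0.
Hypothesis f_surj : forall y, exists x, f x = y.

Let fq (x : {ideal_quot I}) : B := f (repr x).

Let fq_pi x : fq (\pi_({ideal_quot I}) x)%qT = f x.
Proof.
apply/eqP; rewrite -subr_eq0 -rmorphB; apply/eqP/ker_f.
by rewrite Quotient.idealrBE reprK.
Qed.

Let fq_zmod : zmod_morphism fq.
Proof.
move=> x y; rewrite -[x]reprK -[y]reprK -rmorphB.
by rewrite /= !fq_pi rmorphB.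
Qed.

Let fq_monoid : monoid_morphism fq.
Proof.
split=> [|x y]; first by rewrite -(rmorph1 (\pi_({ideal_quot I}))%qT) fq_pi rmorph1.
by rewrite -[x]reprK -[y]reprK -rmorphM /= !fq_pi rmorphM.
Qed.

Let fqM : {rmorphism {ideal_quot I} -> B} :=
  HB.pack_for {rmorphism {ideal_quot I} -> B} fq
    (GRing.isZmodMorphism.Build _ _ fq fq_zmod)
    (GRing.isMonoidMorphism.Build _ _ fq fq_monoid).

(** Preimages under [f] are picked by choice; injectivity of [fq] then transfers its morphism laws
    to [gq]. *)
Let gq (y : B) : {ideal_quot I} :=
  (\pi_({ideal_quot I}) (projT1 (cid (f_surj y))))%qT.

Let gqK : cancel gq fq.
Proof. by move=> y; rewrite /gq fq_pi; case: cid. Qed.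

Let fq_inj : injective fq.
Proof.
move=> x y; rewrite -[x]reprK -[y]reprK !fq_pi => fxy.
apply/eqP; rewrite -Quotient.idealrBE; apply/ker_f.
by rewrite rmorphB fxy subrr.
Qed.

Let fqK : cancel fq gq.
Proof. by move=> x; apply: fq_inj; rewrite gqK. Qed.

Let gq_zmod : zmod_morphism gq.
Proof. by move=> x y; apply: fq_inj; rewrite fq_zmod !gqK. Qed.

Let gq_monoid : monoid_morphism gq.
Proof.
by split=> [|x y]; apply: fq_inj; rewrite ?fq_monoid.1 ?fq_monoid.2 !gqK.
Qed.

Let gqM : {rmorphism B -> {ideal_quot I}} :=
  HB.pack_for {rmorphism B -> {ideal_quot I}} gq
    (GRing.isZmodMorphism.Build _ _ gq gq_zmod)
    (GRing.isMonoidMorphism.Build _ _ gq gq_monoid).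

Lemma has_krull_dim_quot d :
  has_krull_dim B d -> has_krull_dim {ideal_quot I} d.
Proof. exact: (@has_krull_dim_iso _ _ fqM gqM d fqK gqK). Qed.
End Quotient.

(** * Prime ideals of univariate polynomials over a field *)

Section Polynomials.
Variable F : fieldType.

(** By Euclidean division, a nonzero [q] of least size in [P] generates [P]. If [g] lies in [Q] but
    not in [P], primality of [P] makes [q] and [g] coprime, and Bezout puts 1 in the proper ideal
    [Q]. *)
Lemma prime_poly_maximal (P Q : prime_idealr {poly F}) p :
  p != 0 -> p \in P -> {subset P <= Q} -> {subset Q <= P}.
Proof.
move=> p0 pP PQ g gQ; apply/negPn/negP => gP.
have [q [q0 qP qmin]] : exists q, [/\ q != 0, q \in P &
    forall r, r != 0 -> r \in P -> (size q <= size r)%N].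
  have [k] := ubnP (size p); elim: k p p0 pP => // k IHk p p0 pP p_k.
  case: (pselect (exists r, [/\ r != 0, r \in P & (size r < size p)%N])).
    by case=> r [r0 rP r_p]; apply: (IHk r) => //; apply: leq_trans r_p _.
  move=> nr; exists p; split=> // r r0 rP; rewrite leqNgt; apply/negP => rp.
  by apply: nr; exists r.
have qdvd r : r \in P -> q %| r.
  move=> rP; apply/negPn/negP => qr.
  have mP : r %% q \in P.
    have -> : r %% q = - (r %/ q) * q + r.
      by rewrite {3}(divp_eq r q) mulNr addKr.
    by rewrite rpredD // idealMr.
  by have := qmin _ qr mP; rewrite leqNgt ltn_modp q0.
have dvdP r : q %| r -> r \in P.
  by move=> qr; rewrite (divp_eq r q) (modp_eq0 qr) addr0 idealMr.
(* One factor of [q = e * d] lies in [P]. It cannot be [d], for [q] would divide [g]; so [q] divides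
   [e], and comparing sizes shows that [d] is constant. *)
have := divpK (dvdp_gcdl q g); set d := gcdp q g; set e := q %/ d => de.
have : (e \in P) || (d \in P) by rewrite -prime_idealrM de.
case/orP=> [/qdvd q_e | /qdvd q_d]; last first.
  by move/negP: gP; apply; apply: dvdP; apply: dvdp_trans q_d (dvdp_gcdr _ _).
have e0 : e != 0 by apply: contraNneq q0 => e0; rewrite -de e0 mul0r.
have d0 : d != 0 by apply: contraNneq q0 => d0; rewrite -de d0 mulr0.
have cop : coprimep q g.
  have := dvdp_leq e0 q_e; rewrite -{1}de size_mul // coprimep_def -/d.
  rewrite -size_poly_gt0 in d0; rewrite -size_poly_gt0 in e0.
  by rewrite eqn_leq d0 andbT -subn1 leq_subLR addnC leq_add2r.
have [[u v] /= uv] := Bezout_eq1_coprimepP q g cop.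
have := idealr1 Q; rewrite -uv rpredD // idealMr //.
exact: PQ.
Qed.

Let zero_ideal : idealr_closed (pred1 0 : pred {poly F}).
Proof.
split=> [||a u v]; rewrite !inE ?oner_eq0 //.
by move=> /eqP-> /eqP->; rewrite mulr0 addr0.
Qed.

Let zero_prime : prime_idealr_closed (pred1 0 : pred {poly F}).
Proof. by move=> u v; rewrite !inE mulf_eq0. Qed.

(** The ideal generated by ['X], described by the root 0 so that primality is [rootM]. *)
Let X_ideal : idealr_closed (fun p : {poly F} => root p 0).
Proof.
split=> [||a u v]; rewrite !unfold_in /root.
- by rewrite horner0.
- by rewrite hornerC oner_eq0.
- by move=> /eqP u0 /eqP v0; rewrite hornerD hornerM u0 v0 mulr0 addr0.
Qed.

Let X_prime : prime_idealr_closed (fun p : {poly F} => root p 0).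
Proof. by move=> u v; rewrite !unfold_in rootM. Qed.

(** The zero ideal and the ideal of ['X] form a chain. In a longer chain, [P 1] has an element
    outside [P 0], hence nonzero, and [prime_poly_maximal] contradicts strictness of the next
    inclusion. *)
Lemma has_krull_dim_poly : has_krull_dim {poly F} 1.
Proof.
split.
  exists (fun a => if a is 0%N then make_prime zero_ideal zero_prime
                   else make_prime X_ideal X_prime).
  move=> [|//] _; split=> [x|X0].
    by rewrite !make_primeE => /eqP ->; rewrite root0.
  by have := X0 'X; rewrite !make_primeE rootX eqxx /= polyX_eq0 => /(_ isT).
move=> [|[|d]] // P chP; exfalso.
have [P01 P10] := chP 0%N isT; have [P12 P21] := chP 1%N isT.
apply: P21.
have [p [pP1 pP0]] : exists p, p \in P 1%N /\ p \notin P 0%N.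
  apply: contrapT => nP; apply: P10 => p pP1.
  by apply/negPn/negP => pP0; apply: nP; exists p.
apply: (@prime_poly_maximal _ _ p) => //.
by apply: contraNneq pP0 => ->; exact: rpred0.
Qed.
End Polynomials.
End KrullDimension.

(** * Algebraic geometry of an infinite subset of an affine line *)

Section AffineLine.
Variables (R : realType) (m : nat).
Local Notation mpolyR := (mpoly m R).

(** Constants and variables generate the ring, so identities between ring morphisms need checking
    only there. *)
Lemma mpoly_ring_ind (P : mpolyR -> Prop) :
  (forall c, P (mpolyC m c)) -> (forall k, P (mpolyX R (mnm1 k))) ->
  (forall p q, P p -> P q -> P (p + q)) ->
  (forall p q, P p -> P q -> P (p * q)) -> forall p, P p.
Proof.
move=> PC PX PD PM; elim/mpolyind; first by rewrite -mpolyC0.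
move=> c e p _ _ Pp; apply: PD => //; rewrite -mul_mpolyC; apply: (PM) => //.
rewrite mpolyXE_id; apply: big_ind => [|p1 p2|k _]; first by rewrite -mpolyC1.
  exact: PM.
elim: (e k) => [|d IHd]; first by rewrite expr0 -mpolyC1.
by rewrite exprS; apply: PM.
Qed.

Lemma zariski_closure_vanishing (T T' : set 'rV[R]_m) :
  vanishing T = vanishing T' -> zariski_closure T = zariski_closure T'.
Proof. by rewrite /zariski_closure => ->. Qed.

Variables (u v : 'rV[R]_m) (k0 : 'I_m).
Hypothesis v_k0 : v 0 k0 != 0.

Definition aline (t : R) : 'rV[R]_m := u + t *: v.

(** Restriction to the line, with ['X] standing for the parameter [t] of [aline]. *)
Definition line_poly : mpolyR -> {poly R} :=
  mmap polyC (fun k => (u 0 k)%:P + v 0 k *: 'X).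

HB.instance Definition _ := GRing.RMorphism.on line_poly.

Lemma horner_line_poly p t : (line_poly p).[t] = peval (aline t) p.
Proof.
elim/mpoly_ring_ind: p => [c|k|p q IHp IHq|p q IHp IHq].
- by rewrite /line_poly mmapC hornerC /peval mevalC.
- by rewrite /line_poly mmapX mmap1U /peval mevalXU !hornerE !mxE mulrC.
- by rewrite rmorphD hornerD IHp IHq /peval mevalD.
- by rewrite rmorphM hornerM IHp IHq /peval mevalM.
Qed.

(** An affine form whose value at a point of the line is the parameter of that point. *)
Definition line_coord : mpolyR :=
  mpolyC m (v 0 k0)^-1 * (mpolyX R (mnm1 k0) - mpolyC m (u 0 k0)).

(** Substituting [line_coord] for the variable gives a ring-theoretic section of the restriction
    [line_poly]. *)
Definition line_section (q : {poly R}) : mpolyR :=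
  (map_poly (@mpolyC m R) q).[line_coord].

Lemma line_coordE : line_poly line_coord = 'X.
Proof.
rewrite rmorphM rmorphB /= /line_poly !mmapC mmapX mmap1U addrAC subrr add0r.
by rewrite mul_polyC scalerA mulVf ?scale1r.
Qed.

Lemma line_sectionK : cancel line_section line_poly.
Proof.
rewrite /line_section; move: line_coord line_coordE => x xE q.
elim/poly_ind: q => [|q c IHq].
  by rewrite rmorph0 horner0 rmorph0.
rewrite rmorphD rmorphM /= map_polyX map_polyC !hornerE rmorphD rmorphM /= IHq.
by rewrite xE /line_poly /= mmapC.
Qed.

(** The affine equation [x_k = u_k + v_k t] with [t] replaced by [line_coord]; for [k = k0] it is
    the zero polynomial. *)
Definition line_eq (k : 'I_m) : mpolyR :=
  mpolyX R (mnm1 k) - line_section ((u 0 k)%:P + v 0 k *: 'X).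

(* Both sides of the congruence are ring morphisms in [p], so it suffices to
   check it on constants and variables. *)
Lemma sub_line_section p :
  exists c : 'I_m -> mpolyR,
    p - line_section (line_poly p) = \sum_k c k * line_eq k.
Proof.
have secD : {morph line_section : p q / p + q}.
  by move=> a b; rewrite /line_section rmorphD hornerD.
have secM : {morph line_section : p q / p * q}.
  by move=> a b; rewrite /line_section rmorphM hornerM.
elim/mpoly_ring_ind: p => [c|k|p q [c Hc] [d Hd]|p q [c Hc] [d Hd]].
- exists (fun=> 0); rewrite /line_poly mmapC /line_section map_polyC hornerC subrr.
  by rewrite big1 // => k _; rewrite mul0r.
- exists (fun l => (l == k)%:R); rewrite /line_poly mmapX mmap1U.
  rewrite (bigD1 k) //= eqxx mul1r big1 ?addr0 // => l /negPf ->.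
  by rewrite mul0r.
- exists (fun k => c k + d k); rewrite rmorphD secD opprD addrACA Hc Hd.
  by rewrite -big_split; apply: eq_bigr => k _; rewrite mulrDl.
- exists (fun k => p * d k + line_section (line_poly q) * c k).
  transitivity (p * (q - line_section (line_poly q)) +
                line_section (line_poly q) * (p - line_section (line_poly p))).
    by rewrite rmorphM secM !mulrBr addrA [_ * p]mulrC subrK [X in _ - X]mulrC.
  rewrite Hc Hd !mulr_sumr -big_split; apply: eq_bigr => k _.
  by rewrite mulrDl !mulrA.
Qed.

Lemma line_poly_eq k : line_poly (line_eq k) = 0.
Proof.
by rewrite rmorphB /= line_sectionK /line_poly mmapX mmap1U subrr.
Qed.

Variable D : set R.
Hypothesis D_infinite : infinite_set D.

(** A univariate polynomial with infinitely many roots is zero, so the vanishing ideal is the kernel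
    of [line_poly], whatever the infinite set [D]. *)
Lemma vanishing_line p : vanishing (aline @` D) p <-> line_poly p = 0.
Proof.
split=> [vp|p0 _ [t _ <-]]; last by rewrite -horner_line_poly p0 horner0.
have [B BD B_size] := infinite_set_fset (size (line_poly p)) D_infinite.
apply: (@roots_geq_poly_eq0 _ _ (finmap.enum_fset B)) => //.
  apply/allP => t Bt; rewrite /root horner_line_poly vp //.
  by exists t => //; apply: BD.
exact: finmap.fset_uniq.
Qed.

Lemma vanishing_line_eq p :
  vanishing (aline @` D) p <-> exists c, p = \sum_k c k * line_eq k.
Proof.
rewrite vanishing_line; split=> [p0 | [c ->]].
  have [c pc] := sub_line_section p; exists c.
  by rewrite -pc p0 /line_section rmorph0 horner0 subr0.
by rewrite rmorph_sum big1 // => k _; rewrite rmorphM /= line_poly_eq mulr0.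
Qed.

Let I_pred : pred mpolyR := fun p => `[< vanishing (aline @` D) p >].

Let I_predE p : (p \in I_pred) = (line_poly p == 0).
Proof. by apply/asboolP/eqP; rewrite vanishing_line. Qed.

Let I_closed : idealr_closed I_pred.
Proof.
split=> [||a p q]; rewrite !I_predE; first by rewrite rmorph0.
  by rewrite rmorph1 oner_eq0.
by move=> /eqP p0 /eqP q0; rewrite rmorphD rmorphM /= p0 q0 mulr0 addr0.
Qed.

Let I : idealr mpolyR := HB.pack_for (idealr mpolyR) I_pred
  (isIdealr.Build mpolyR I_pred I_closed).

(** [line_poly] identifies the coordinate ring with [{poly R}]. *)
Lemma has_dim_line : has_dim (aline @` D) 1.
Proof.
exists I => [p|]; first by split=> /asboolP.
apply: (@has_krull_dim_quot _ _ I line_poly) (has_krull_dim_poly R) => [p|q].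
  have -> : (p \in I) = (line_poly p == 0) := I_predE p.
  by split=> /eqP.
by exists (line_section q); apply: line_sectionK.
Qed.


(** A component is maximal, and [Z] itself competes with it. *)
Lemma irreducible_component_irreducible (Z Z' : set 'rV[R]_m) :
  zariski_closed Z -> zariski_irreducible Z ->
  irreducible_component Z Z' <-> Z' = Z.
Proof.
move=> Z_closed Z_irr; split=> [[Z'Z Z'_closed Z'_irr maxZ'] | ->].
  by rewrite -(maxZ' Z).
by split=> // Z'' Z''Z _ _ ZZ''; apply/seteqP; split.
Qed.

Let line := range aline.

Let line_vanishing p : vanishing line p <-> line_poly p = 0.
Proof.
split=> [vp|p0 _ [t _ <-]]; last by rewrite -horner_line_poly p0 horner0.
by apply/vanishing_line => x [t _ <-]; apply: vp; exists t.
Qed.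

Let line_vanishing_eq : vanishing line = vanishing (aline @` D).
Proof.
by apply/seteqP; split=> p; [move/line_vanishing/vanishing_line |
   move/vanishing_line/line_vanishing].
Qed.

(** A point of the closure satisfies every [line_eq k], which says that it is the point of the line
    with parameter [line_coord]. Conversely, the whole line has the same vanishing ideal. *)
Lemma zariski_closure_line : zariski_closure (aline @` D) = range aline.
Proof.
apply/seteqP; split=> [x cx | x lx p]; last first.
  by rewrite -line_vanishing_eq; apply.
exists (peval x line_coord) => //; apply/rowP => k.
have /cx : vanishing (aline @` D) (line_eq k).
  by apply/vanishing_line/line_poly_eq.
rewrite /line_eq /line_section rmorphD /= map_polyC map_polyZ map_polyX /=.
rewrite hornerD hornerC hornerZ hornerX /peval mevalB mevalD mevalC mevalM mevalC.
by move/eqP; rewrite mevalXU subr_eq0 => /eqP ->; rewrite !mxE mulrC.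
Qed.

Lemma zariski_closed_line : zariski_closed line.
Proof.
rewrite /zariski_closed -[RHS]zariski_closure_line.
exact/zariski_closure_vanishing/line_vanishing_eq.
Qed.

(** If neither [A] nor [B] contains the line, some [p] vanishing on [A] and some [q] vanishing on
    [B] have nonzero restrictions, while [p * q] restricts to 0 in the domain [{poly R}]. *)
Lemma zariski_irreducible_line : zariski_irreducible line.
Proof.
split=> [|A B A_closed B_closed lAB]; first by exists (aline 0), 0.
case: (pselect (line `<=` A)); first by left.
case: (pselect (line `<=` B)); first by right.
move=> /existsNP[x /not_implyP[lx Bx]] /existsNP[y /not_implyP[ly Ay]].
move: Bx Ay; rewrite -{1}A_closed -{1}B_closed.
move=> /existsNP[q /not_implyP[Bq qx]] /existsNP[p /not_implyP[Ap py]].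
have : line_poly (p * q) = 0.
  apply/line_vanishing => z /lAB[Az|Bz]; rewrite /peval mevalM.
    by rewrite -/(peval z p) Ap // mul0r.
  by rewrite -/(peval z q) Bq // mulr0.
rewrite rmorphM => /eqP; rewrite mulf_eq0 => /orP[] /eqP /line_vanishing v0.
  by exfalso; apply: py; apply: v0.
by exfalso; apply: qx; apply: v0.
Qed.

(** The generators are affine, so the matrix does not depend on [x]. *)
Lemma jacobian_line x :
  Defs.jacobian line_eq x = 1%:M - (v 0 k0)^-1 *: (v^T *m delta_mx 0 k0).
Proof.
apply/matrixP => a b; rewrite !mxE big_ord1 !mxE eqxx /=.
rewrite /line_eq /line_section rmorphD /= map_polyC map_polyZ map_polyX /=.
rewrite hornerD hornerC hornerZ hornerX /line_coord.
rewrite mderivB mderivD mderivC add0r !mderiv_mulC mderivB mderivC subr0.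
rewrite !mderivX /peval mevalB !mevalM !mevalC !mevalZ.
(* Monomial subtraction is truncated; when [k] differs from [b], the coefficient 0 hides the
   resulting monomial. *)
have mevX k : (mnm1 k b)%:R *
    meval (fun k => x 0 k) (mpolyX R (mnm_sub (mnm1 k) (mnm1 b)))
    = (k == b)%:R.
  rewrite mnm1E; case: eqP => [->|_]; last by rewrite mul0r.
  by rewrite mul1r mevalX big1 // => l _; rewrite mnmBE subnn expr0.
by rewrite !mevX [b == k0]eq_sym mulrCA.
Qed.

(** The transposed Jacobian sends [y] to [y - (y_k0 / v_k0) v], so its kernel is spanned by [v]. *)
Lemma rank_kermx_jacobian_line x : \rank (kermx (Defs.jacobian line_eq x)^T) = 1%N.
Proof.
have JT : (Defs.jacobian line_eq x)^T = 1%:M - (v 0 k0)^-1 *: (delta_mx k0 0 *m v).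
  by rewrite jacobian_line linearB linearZ /= trmx1 trmx_mul trmxK trmx_delta.
have mulJ y : y *m (Defs.jacobian line_eq x)^T = y - (y 0 k0 / v 0 k0) *: v.
  rewrite JT mulmxBr mulmx1 -scalemxAr mulmxA -colE.
  congr (_ - _); apply/rowP => l; rewrite !mxE big_ord1 !mxE.
  by rewrite mulrA [_^-1 * _]mulrC.
have -> : (kermx (Defs.jacobian line_eq x)^T :=: v)%MS.
  apply/eqmxP/andP; split; last first.
    by apply/sub_kermxP; rewrite mulJ divff // scale1r subrr.
  apply/rV_subP => y /sub_kermxP; rewrite mulJ => /eqP; rewrite subr_eq0 => /eqP ->.
  exact: scalemx_sub.
have v0 : v != 0 by apply: contraNneq v_k0 => ->; rewrite mxE.
by rewrite rank_rV v0.
Qed.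

(** The closure is irreducible, hence its own only component, and the kernel rank 1 agrees with
    [has_dim_line]. *)
Lemma smooth_line : smooth (aline @` D).
Proof.
move=> x Dx; rewrite zariski_closure_line; exists line.
have comp Z := irreducible_component_irreducible Z
  zariski_closed_line zariski_irreducible_line.
have lx : line x by case: Dx => t _ <-; exists t.
split=> //; [exact/comp | by move=> Z' /comp |].
exists m, line_eq; split.
  by move=> p; rewrite line_vanishing_eq vanishing_line_eq.
by rewrite rank_kermx_jacobian_line /has_dim line_vanishing_eq; apply: has_dim_line.
Qed.

End AffineLine.

(** * Positive definite matrices, decoupled indices and direct sums *)

Section PositiveDefinite.
Variable R : realType.

Lemma PD_unitmx n (A : 'M[R]_n) : PD A -> A \in unitmx.
Proof.
case=> _ A_pos; rewrite -row_free_unit; apply: inj_row_free => x xA.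
by apply/eqP; apply: contraT => /A_pos; rewrite xA mul0mx mxE ltxx.
Qed.

(* The vector [x = e_k K - K_kk e_k] satisfies [x S x^T = K_kk (K_kk S_kk - 1)],
   hence vanishes. *)
Lemma PD_decoupled n (S : 'M[R]_n) k :
  PD S -> S k k * invmx S k k = 1 -> forall l, l != k -> S k l = 0.
Proof.
move=> S_PD; have S_unit := PD_unitmx S_PD; case: S_PD => S_sym S_pos SK1.
set K := invmx S in SK1; pose e : 'rV[R]_n := delta_mx 0 k.
have eM (M : 'M[R]_n) l : (e *m M) 0 l = M k l by rewrite -rowE mxE.
have Me (x : 'rV[R]_n) : (x *m e^T) 0 0 = x 0 k by rewrite trmx_delta -colE mxE.
have K_sym : K^T = K by rewrite trmx_inv S_sym.
pose x := e *m K - K k k *: e.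
have xS : x *m S = e - K k k *: (e *m S).
  by rewrite mulmxBl mulmxKV // scalemxAl.
have x0 : x = 0.
  apply/eqP; apply: contraT => /S_pos.
  have -> : x *m S *m x^T = x *m e^T - K k k *: (x *m S *m e^T).
    rewrite {2}/x linearB linearZ /= trmx_mul K_sym mulmxBr mulmxA mulmxK //.
    by rewrite -scalemxAr.
  have subE p (y z : 'rV[R]_p) c l : (y - c *: z) 0 l = y 0 l - c * z 0 l.
    by rewrite !mxE.
  have ek : e 0 k = 1 by rewrite mxE !eqxx.
  rewrite subE !Me xS /x !subE !eM ek mulr1 subrr sub0r.
  by rewrite [K k k * S k k]mulrC SK1 subrr mulr0 oppr0 ltxx.
(* Since [x = 0], row [k] of [S] times [K k k] is the unit vector, and [K k k] is nonzero by
   [SK1]. *)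
have eS : e = K k k *: (e *m S).
  by apply/eqP; rewrite -subr_eq0 -xS x0 mul0mx.
move=> l lk; have /rowP/(_ l) := eS.
rewrite [LHS]mxE [RHS]mxE eM (negPf lk) andbF => /esym/eqP.
rewrite mulf_eq0 => /orP[/eqP K0|/eqP //].
by move: SK1; rewrite K0 mulr0 => /esym/eqP; rewrite oner_eq0.
Qed.

(** The unit row vector at [k] is a left eigenvector of [S] for [S k k], hence [S k k] times row [k]
    of the inverse is that unit vector; its entry at [k] shows that [S k k] is nonzero. *)
Lemma invmx_decoupled n (S : 'M[R]_n) k :
  S \in unitmx -> (forall l, l != k -> S k l = 0) ->
  forall l, l != k -> invmx S k l = 0.
Proof.
move=> S_unit Sk l lk; pose e : 'rV[R]_n := delta_mx 0 k.
have eS : e *m S = S k k *: e.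
  apply/rowP => l'; rewrite -rowE !mxE eqxx /=.
  by case: eqVneq => [->|/Sk ->]; rewrite ?mulr1 ?mulr0.
have eSK : e = S k k *: (e *m invmx S) by rewrite scalemxAl -eS mulmxK.
have eM l' : (e *m invmx S) 0 l' = invmx S k l' by rewrite -rowE mxE.
have eK l' : e 0 l' = S k k * invmx S k l' by rewrite {1}eSK [LHS]mxE eM.
have := eK k; have := eK l; rewrite !mxE !eqxx (negPf lk) /= => /esym/eqP.
rewrite mulf_eq0 => /orP[/eqP ->|/eqP //].
by rewrite mul0r => /eqP; rewrite oner_eq0.
Qed.

Section DirectSum.
Variables (n : nat) (P : {set {set 'I_n}}).

(** Rows of the identity: right multiplication by [incl B] extends a vector by zero, and taking a
    block becomes a congruence. *)
Let incl (B : {set 'I_n}) : 'M[R]_(#|B|, n) :=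
  rowsub (fun a : 'I_#|B| => enum_val a) 1%:M.

Let blockE (B : {set 'I_n}) (A : 'M[R]_n) : block B A = incl B *m A *m (incl B)^T.
Proof.
rewrite /incl trmx_mxsub trmx1 mulmx_colsub mulmx1 mul_rowsub_mx mul1mx.
by apply/matrixP => a b; rewrite !mxE.
Qed.

Lemma PD_block (B : {set 'I_n}) (A : 'M[R]_n) : PD A -> PD (block B A).
Proof.
case=> A_sym A_pos; split=> [|x x0]; first by rewrite /block trmx_mxsub A_sym.
have -> : x *m block B A *m x^T = (x *m incl B) *m A *m (x *m incl B)^T.
  by rewrite blockE trmx_mul !mulmxA.
apply: A_pos; apply: contraNneq x0 => xB.
have inclK : incl B *m (incl B)^T = 1%:M.
  rewrite -{1}[incl B]mulmx1 -blockE; apply/matrixP => a b; rewrite !mxE.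
  by rewrite (inj_eq enum_val_inj).
by rewrite -[x]mulmx1 -inclK mulmxA xB mul0mx.
Qed.

Hypothesis P_part : finset.partition P [set: 'I_n]%SET.

(** The quadratic form of [A] is the sum of those of its blocks applied to the restrictions of [x].
    All terms are nonnegative, and the one for a block containing a nonzero coordinate of [x] is
    positive. *)
Lemma direct_sum_PD (A : 'M[R]_n) :
  direct_sum P PD_of A <->
  PD A /\ forall k l,
    (forall B, B \in P -> ~~ ((k \in B) && (l \in B))) -> A k l = 0.
Proof.
split=> [[A_PD A0] | [A_PD A0]]; last by split=> // B _; apply: PD_block.
split=> //.
have [/eqP P_cover P_triv _] := and3P P_part.
have P_ex k : exists2 B, B \in P & k \in B.
  have : k \in finset.cover P by rewrite P_cover finset.in_setT.
  by case/finset.bigcupP => B; exists B.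
have P_uniq k B B' : B \in P -> B' \in P -> k \in B -> k \in B' -> B = B'.
  move=> BP B'P kB kB'; rewrite -(finset.def_pblock P_triv BP kB).
  exact: finset.def_pblock P_triv B'P kB'.
have A_sum : A = \sum_(B in P) (incl B)^T *m block B A *m incl B.
  have ent B k l : ((incl B)^T *m block B A *m incl B) k l =
      A k l *+ ((k \in B) && (l \in B)).
    (* The coordinate projector onto [B]; [D *m A *m D] keeps exactly the entries with both indices
       in [B]. *)
    pose D : 'M[R]_n := diag_mx (\row_k (k \in B)%:R).
    have DE : (incl B)^T *m incl B = D.
      apply/matrixP => a b; rewrite !mxE.
      transitivity (\sum_(c in B) (c == a)%:R * (c == b)%:R : R).
        by rewrite [RHS]big_enum_val; apply: eq_bigr => c _; rewrite !mxE.
      case: (boolP (a \in B)) => aB.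
        rewrite (bigD1 a) //= eqxx mul1r big1 ?addr0 // => c /andP[_ /negPf ->].
        by rewrite mul0r.
      rewrite big1 => [|c cB]; first by rewrite mul0rn.
      by case: eqP => [ca|]; rewrite ?mul0r //; rewrite -ca cB in aB.
    rewrite blockE !mulmxA DE -mulmxA DE mul_mx_diag mul_diag_mx !mxE.
    by case: (_ \in B); case: (_ \in B); rewrite ?(mul1r, mul0r, mulr1, mulr0).
  apply/matrixP => k l; rewrite summxE; have [B BP kB] := P_ex k.
  rewrite (bigD1 B) //= ent kB /= big1 ?addr0 => [|B' /andP[B'P B'B]]; last first.
    rewrite ent; case: (boolP (k \in B')) => // kB'.
    by rewrite (P_uniq k B' B) ?eqxx in B'B.
  case: (boolP (l \in B)) => // lB; rewrite A0 // => B' B'P.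
  apply/negP => /andP[kB' lB']; move: lB.
  by rewrite (P_uniq k B B') // lB'.
split=> [|x x0].
  rewrite A_sum linear_sum; apply: eq_bigr => B BP /=.
  by rewrite !trmx_mul trmxK (A_PD B BP).1 mulmxA.
have xAx : (x *m A *m x^T) 0 0 =
    \sum_(B in P) ((x *m (incl B)^T) *m block B A *m (x *m (incl B)^T)^T) 0 0.
  rewrite {1}A_sum mulmx_sumr mulmx_suml summxE; apply: eq_bigr => B _.
  by rewrite trmx_mul trmxK !mulmxA.
have term_ge0 B : B \in P ->
    0 <= ((x *m (incl B)^T) *m block B A *m (x *m (incl B)^T)^T) 0 0.
  move=> BP; case: (eqVneq (x *m (incl B)^T) 0) => [->|y0].
    by rewrite !mul0mx mxE.
  exact/ltW/(A_PD B BP).2.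
have /rV0Pn[k xk] := x0; have [B BP kB] := P_ex k.
rewrite xAx (bigD1 B) //= ltr_wpDr //.
  by apply: sumr_ge0 => B' /andP[B'P _]; apply: term_ge0.
apply: (A_PD B BP).2; apply/rV0Pn; exists (enum_rank_in kB k).
by rewrite trmx_mxsub trmx1 mulmx_colsub mulmx1 mxE enum_rankK_in.
Qed.
End DirectSum.
End PositiveDefinite.

Lemma infinite_itv_oo (R : realType) : infinite_set `]-1, 1 : R[.
Proof.
move=> fin; apply: infinite_nat.
(* The shift by 2 keeps every reciprocal strictly below 1. *)
have -> : [set: nat] = (fun k => k.+2%:R^-1 : R) @^-1` `]-1, 1 : R[.
  apply/seteqP; split=> // k _ /=; rewrite in_itv /=.
  by rewrite invf_lt1 ?ltr1n ?ltr0n // (lt_trans (ltrN10 _)) // invr_gt0 ltr0n.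
apply: finite_preimage fin => k l _ _ /invr_inj/eqP.
by rewrite eqr_nat !eqSS => /eqP.

Qed.

(** * The model of two graphs sharing a single edge *)

Section SingleEdge.
Variables (R : realType) (n : nat) (i j : 'I_n).
Hypothesis ij : i != j.

Let only_ij (S : 'M[R]_n) : Prop :=
  forall k l, k != l -> (k, l) != (i, j) -> (k, l) != (j, i) -> S k l = 0.

Let pair_eq k l : k != l ->
  ([set k; l]%SET == [set i; j]%SET) = ((k, l) == (i, j)) || ((k, l) == (j, i)).
Proof.
move=> kl; rewrite !xpair_eqE; apply/eqP/orP => [E|[] /andP[/eqP-> /eqP->] //].
  have : k \in [set i; j]%SET by rewrite -E finset.set21.
  have : l \in [set i; j]%SET by rewrite -E finset.set22.
  by move: kl; rewrite !finset.in_set2 => kl /orP[] /eqP lE /orP[] /eqP kE; subst k l;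
    rewrite ?eqxx // in kl *; [right | left].
by rewrite finset.setUC.
Qed.

(** Left to right, every vertex outside the edge is shown to be decoupled by [PD_decoupled].
    Conversely, [invmx_decoupled] gives the inverse the same zero pattern, and the remaining pair is
    an edge of both graphs. *)
Lemma model_single_edge (G H : sgraph n) :
  edges G :&: edges H = [set [set i; j]]%SET ->
  model R G H = [set S | PD S /\ only_ij S].
Proof.
move=> GH.
have GHE e : (e \in edges G) && (e \in edges H) = (e == [set i; j]%SET).
  by rewrite -finset.in_setI GH finset.in_set1.
have decoupled S k l : only_ij S -> k != i -> k != j -> l != k -> S k l = 0.
  move=> S0 /negPf ki /negPf kj lk.
  by apply: S0; [rewrite eq_sym | rewrite xpair_eqE ki | rewrite xpair_eqE kj].
apply/seteqP; split=> S /=.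
- case=> S_PD KG SH; split=> // k l kl.
  (* In the diagonal entry of [S *m invmx S] at [k'], an off-diagonal term needs an edge of both
     graphs at [k'], and the only common edge avoids [k']. *)
  have SK1 k' : k' != i -> k' != j -> S k' k' * invmx S k' k' = 1.
    move=> ki kj; have := mulmxV (PD_unitmx S_PD) => /matrixP/(_ k' k').
    rewrite !mxE eqxx (bigD1 k') //= big1 ?addr0 // => m mk.
    have : ~~ ((([set k'; m]%SET) \in edges G) && ([set k'; m]%SET \in edges H)).
      have km : k' != m by rewrite eq_sym.
      rewrite GHE pair_eq // !xpair_eqE.
      by rewrite (negPf ki) (negPf kj).
    rewrite negb_and => /orP[kmG|kmH]; last by rewrite SH ?mul0r // eq_sym.
    by rewrite KG ?mulr0 // finset.setUC.
  have S_sym := S_PD.1.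
  case: (boolP ((k == i) || (k == j))) => [kij|]; last first.
    rewrite negb_or => /andP[ki kj] _ _.
    by apply: (PD_decoupled S_PD (SK1 k ki kj)); rewrite eq_sym.
  case: (boolP ((l == i) || (l == j))) => [lij|]; last first.
    rewrite negb_or => /andP[li lj] _ _; rewrite -S_sym mxE.
    exact: (PD_decoupled S_PD (SK1 l li lj)).
  move: kij lij kl; rewrite !xpair_eqE.
  by move=> /orP[] /eqP -> /orP[] /eqP ->; rewrite ?eqxx.
- case=> S_PD S0; have S_unit := PD_unitmx S_PD.
  have K_sym : (invmx S)^T = invmx S by rewrite trmx_inv S_PD.1.
  have ijG : [set i; j]%SET \in edges G.
    by have := GHE [set i; j]%SET; rewrite eqxx => /andP[].
  have ijH : [set i; j]%SET \in edges H.
    by have := GHE [set i; j]%SET; rewrite eqxx => /andP[].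
  split=> // k l kl klN.
    have : [set k; l]%SET != [set i; j]%SET by apply: contraNneq klN => ->.
    rewrite pair_eq // negb_or !xpair_eqE => klij.
    have Kk m m' : m != i -> m != j -> m' != m -> invmx S m m' = 0.
      by move=> mi mj; apply: invmx_decoupled => // m''; apply: decoupled.
    case: (boolP ((k == i) || (k == j))) => [kij|]; last first.
      by rewrite negb_or => /andP[ki kj]; rewrite Kk // eq_sym.
    case: (boolP ((l == i) || (l == j))) => [lij|]; last first.
      by rewrite negb_or => /andP[li lj]; rewrite -K_sym mxE Kk.
    move: kij lij kl klij.
    by move=> /orP[] /eqP -> /orP[] /eqP ->; rewrite ?eqxx /= ?andbF.
  have : [set k; l]%SET != [set i; j]%SET by apply: contraNneq klN => ->.
  by rewrite pair_eq // negb_or => /andP[]; apply: S0.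
Qed.

Let P : {set {set 'I_n}} :=
  ([set i; j] |: [set [set k] | k in ~: [set i; j]])%SET.

(** The class of [k] in [P]; the partition axioms reduce to [block_ofE], its uniqueness. *)
Let block_of k : {set 'I_n} :=
  if k \in [set i; j]%SET then [set i; j]%SET else [set k]%SET.

Let mem_block_of k : k \in block_of k.
Proof. by rewrite /block_of; case: ifP => // _; rewrite finset.set11. Qed.

Let block_of_P k : block_of k \in P.
Proof.
rewrite /P finset.in_setU1 /block_of; case: ifPn => [|kij]; first by rewrite eqxx.
by apply/orP; right; apply: finset.imset_f; rewrite finset.in_setC.
Qed.

Let block_ofE B k : B \in P -> k \in B -> B = block_of k.
Proof.
rewrite /P finset.in_setU1 => /orP[/eqP -> | /finset.imsetP[l lij ->]].
  by rewrite /block_of => ->.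
rewrite finset.in_set1 => /eqP ->.
by rewrite finset.in_setC in lij; rewrite /block_of (negPf lij).
Qed.

Let P_partition : finset.partition P [set: 'I_n]%SET.
Proof.
apply/and3P; split.
- apply/eqP/finset.setP => k; rewrite finset.in_setT; apply/finset.bigcupP.
  by exists (block_of k); [exact: block_of_P | exact: mem_block_of].
- apply/finset.trivIsetP => A B AP BP; apply: contraR.
  rewrite -finset.setI_eq0 => /finset.set0Pn[k].
  by rewrite finset.in_setI => /andP[/(block_ofE AP) -> /(block_ofE BP) ->].
- rewrite /P finset.in_setU1 negb_or; apply/andP; split.
    by rewrite eq_sym; apply/finset.set0Pn; exists i; rewrite finset.set21.
  apply/finset.imsetP => -[k _ /finset.setP/(_ k)].
  by rewrite finset.in_set0 finset.set11.
Qed.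

(** By [direct_sum_PD] only zero patterns are compared: distinct indices share a block exactly when
    they are [i] and [j]. *)
Lemma direct_sum_single_edge :
  direct_sum P PD_of = [set S : 'M[R]_n | PD S /\ only_ij S].
Proof.
apply/seteqP; split=> S /=.
  move=> /(direct_sum_PD P_partition)[S_PD S0]; split=> // k l kl kl1 kl2.
  apply: S0 => B BP; apply/negP => /andP[kB]; rewrite (block_ofE BP kB).
  rewrite /block_of; case: ifPn => [kij|_]; last first.
    by rewrite finset.in_set1 eq_sym (negPf kl).
  move: kij kl kl1 kl2; rewrite !finset.in_set2 !xpair_eqE.
  by move=> /orP[] /eqP -> kl kl1 kl2 /orP[] /eqP lE; subst l;
    rewrite ?eqxx /= in kl kl1 kl2.
case=> S_PD S0; apply/(direct_sum_PD P_partition); split=> // k l kl.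
have ij_P : [set i; j]%SET \in P by rewrite /P finset.in_setU1 eqxx.
apply: S0.
- by apply: contraTneq (kl _ (block_of_P k)) => <-; rewrite negbK mem_block_of.
- apply: contraTneq (kl _ ij_P) => -[-> ->].
  by rewrite finset.set21 finset.set22.
- apply: contraTneq (kl _ ij_P) => -[-> ->].
  by rewrite finset.set21 finset.set22.
Qed.

(** The direction of the line of unit-diagonal matrices. *)
Let F : 'M[R]_n := delta_mx i j + delta_mx j i.

Let F_form (x : 'rV[R]_n) : (x *m F *m x^T) 0 0 = x 0 i * x 0 j *+ 2.
Proof.
have deltaE (k l : 'I_n) : (x *m delta_mx k l *m x^T) 0 0 = x 0 k * x 0 l.
  by rewrite -(mul_delta_mx (0 : 'I_1)) mulmxA -mulmxA -colE -rowE mxE big_ord1 !mxE.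
by rewrite /F mulmxDr mulmxDl mxE !deltaE mulr2n [x 0 j * _]mulrC.
Qed.

Let FE k l : F k l = (((k, l) == (i, j)) || ((k, l) == (j, i)))%:R.
Proof.
rewrite !mxE !xpair_eqE; case: (eqVneq k i) => [->|_] /=.
  by rewrite (negPf ij) orbF addr0.
by rewrite add0r.
Qed.

Let corr_form a (x : 'rV[R]_n) :
  (x *m (1%:M + a *: F) *m x^T) 0 0 = \sum_k x 0 k ^+ 2 + a * (x 0 i * x 0 j *+ 2).
Proof.
rewrite mulmxDr mulmx1 mulmxDl mxE -F_form -scalemxAr -scalemxAl.
congr (_ + _); last by rewrite mxE.
by rewrite mxE; apply: eq_bigr => k _; rewrite mxE.
Qed.

Lemma PD_corr a : PD (1%:M + a *: F) <-> -1 < a < 1.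
Proof.
split=> [[_ pos]|/andP[a_gt a_lt]].
  (* On [e_i + c e_j] with [c ^+ 2 = 1], the form equals [2 (1 + a c)]; the signs of [c] give the
     two bounds. *)
  have test c : c ^+ 2 = 1 -> 0 < 1 + a * c.
    move=> c1; pose x : 'rV[R]_n := delta_mx 0 i + c *: delta_mx 0 j.
    have xi : x 0 i = 1 by rewrite !mxE !eqxx (negPf ij) mulr0 addr0.
    have xj : x 0 j = c by rewrite !mxE !eqxx eq_sym (negPf ij) mulr1 add0r.
    have x0 : x != 0 by apply/rV0Pn; exists i; rewrite xi oner_neq0.
    have := pos x x0; rewrite corr_form (bigD1 i) // (bigD1 j) 1?eq_sym //=.
    rewrite xi xj c1 big1 => [|k /andP[/negPf ki /negPf kj]]; last first.
      by rewrite !mxE ki kj mulr0 addr0 expr0n.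
    by rewrite expr1n mul1r addr0 mulrnAr -mulr2n -mulrnDl pmulrn_lgt0.
  have := test 1 (expr1n _ _); have := test (- 1) (etrans (sqrrN 1) (expr1n _ _)).
  by rewrite mulr1 mulrN1 => ? ?; apply/andP; split; lra.
split.
  rewrite linearD linearZ /= trmx1 /F linearD /= !trmx_delta.
  by rewrite [delta_mx j i + _]addrC.
move=> x x0; rewrite corr_form.
set s := \sum_k _; have s_ge : x 0 i ^+ 2 + x 0 j ^+ 2 <= s.
  rewrite /s (bigD1 i) // (bigD1 j) 1?eq_sym //= addrA lerDl.
  by apply: sumr_ge0 => k _; apply: sqr_ge0.
have s_gt0 : 0 < s.
  have /rV0Pn[k xk] := x0; rewrite /s (bigD1 k) //= ltr_wpDr //.
    by apply: sumr_ge0 => l _; apply: sqr_ge0.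
  by rewrite exprn_even_gt0.
(* These squares bound the absolute value of [2 x_i x_j] by [x_i^2 + x_j^2], hence by [s]; the sign
   of [a] decides which one is needed. *)
have sqr1 := sqr_ge0 (x 0 i + x 0 j); have sqr2 := sqr_ge0 (x 0 i - x 0 j).
rewrite mulr2n; case: (lerP 0 a) => a0; nra.
Qed.

Lemma model1_single_edge (G H : sgraph n) :
  edges G :&: edges H = [set [set i; j]]%SET ->
  model1 R G H = (fun a => 1%:M + a *: F) @` `]-1, 1[.
Proof.
move=> GH; rewrite /model1 (model_single_edge GH); apply/seteqP; split=> S /=.
  case=> [[S_PD S0] S1].
  have SE : S = 1%:M + S i j *: F.
    apply/matrixP => k l; rewrite mxE [(S i j *: F) k l]mxE FE mxE.
    case: (eqVneq k l) => [<-|kl].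
      rewrite S1 !xpair_eqE; case: eqVneq => [->|]; last by rewrite andbF mulr0 addr0.
      by rewrite (negPf ij) mulr0 addr0.
    case: (eqVneq (k, l) (i, j)) => [[-> ->]|kl1]; first by rewrite mulr1 add0r.
    case: (eqVneq (k, l) (j, i)) => [[-> ->]|kl2]; last by rewrite S0 // mulr0 addr0.
    by rewrite mulr1 add0r -{1}S_PD.1 mxE.
  exists (S i j) => //; rewrite in_itv /=; apply/PD_corr.
  by rewrite -SE.
case=> a; rewrite in_itv /= => /PD_corr a_PD <-.
split; first split=> // k l kl kl1 kl2.
  rewrite mxE [(a *: F) k l]mxE FE mxE (negPf kl) (negPf kl1) (negPf kl2).
  by rewrite mulr0 addr0.
move=> k; rewrite mxE [(a *: F) k k]mxE FE mxE eqxx !xpair_eqE.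
case: (eqVneq k i) => [->|_] /=; last by rewrite andbF mulr0 addr0.
by rewrite (negPf ij) mulr0 addr0.
Qed.

Lemma connected_model1_single_edge (G H : sgraph n) :
  edges G :&: edges H = [set [set i; j]]%SET -> connected (model1 R G H).
Proof.
move=> GH; rewrite (model1_single_edge GH).
apply: (@connected_continuous_connected R).
  exact/connected_intervalP/interval_is_interval.
apply: continuous_subspaceT => a /= A [B B_nbhs BA].
(* A matrix neighbourhood contains a product of neighbourhoods [B k l] of the finitely many entries,
   so continuity is checked entrywise. *)
have : \forall t \near a, forall k l, B k l ((1%:M + t *: F) k l).
  apply: (@filter_forall _ _ (fun k t => forall l, B k l _) (nbhs a)) => k.
  apply: (@filter_forall _ _ (fun l t => B k l _) (nbhs a)) => l.
  have entE t : (1%:M + t *: F) k l = (1%:M : 'M[R]_n) k l + t * F k l.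
    by rewrite mxE [(t *: F) k l]mxE.
  have : (fun t => (1%:M + t *: F) k l) @ a --> (1%:M + a *: F) k l.
    rewrite (funext entE) entE; apply: cvgD; first exact: cvg_cst.
    by apply: cvgM; [exact: cvg_id | exact: cvg_cst].
  by apply; apply: B_nbhs.
by apply: filterS => t Bt; apply: BA.
Qed.

Lemma mx_points_model1_single_edge (G H : sgraph n) :
  edges G :&: edges H = [set [set i; j]]%SET ->
  mx_points (model1 R G H) = aline (mxvec 1%:M) (mxvec F) @` `]-1, 1[.
Proof.
move=> GH; rewrite /mx_points (model1_single_edge GH) image_comp.
by apply: eq_imagel => a _ /=; rewrite /aline linearD linearZ.
Qed.

End SingleEdge.

Theorem proposition3p28 (R : realType) (n : nat) (G H : sgraph n) (i j : 'I_n)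
    (hGH : edges G :&: edges H = [set [set i; j]]%SET) :
  [/\ model R G H =
        direct_sum ([set i; j] |: [set [set k] | k in ~: [set i; j]])%SET PD_of,
      model R G H =
        [set S | PD S /\
           forall k l, k != l -> (k, l) != (i, j) -> (k, l) != (j, i) ->
             S k l = 0],
      connected (model1 R G H),
      smooth (mx_points (model1 R G H)) &
      has_dim (mx_points (model1 R G H)) #|edges G :&: edges H| /\
      #|edges G :&: edges H| = 1%N].
Proof.
have ij : i != j.
  have : [set i; j]%SET \in edges G.
    by have := finset.set11 [set i; j]%SET; rewrite -hGH finset.in_setI => /andP[].
  by move/(@edges_card n G); rewrite finset.cards2; case: (i != j).
(* The coordinate [(i, j)] serves as [k0]: the direction has entry 1 there because [i] and [j]
   differ. *)
have v_ij : mxvec (delta_mx i j + delta_mx j i : 'M[R]_n) 0 (mxvec_index i j) != 0.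
  by rewrite mxvecE !mxE !eqxx (negPf ij) /= addr0 oner_eq0.
have card1 : #|edges G :&: edges H| = 1%N by rewrite hGH finset.cards1.
split.
- by rewrite direct_sum_single_edge // (model_single_edge R hGH).
- exact: model_single_edge.
- exact: connected_model1_single_edge hGH.
- rewrite (mx_points_model1_single_edge R ij hGH).
  exact: (smooth_line v_ij (@infinite_itv_oo R)).
- rewrite card1 (mx_points_model1_single_edge R ij hGH); split=> //.
  exact: (has_dim_line _ v_ij (@infinite_itv_oo R)).
Qed.
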